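(* Consider a sequence of experiments indexed by the sample size $n$ in which treatment is assigned by a Bernoulli design for each $n$. The variance estimator $\widehat{\mathrm{Var}}_{SR}(\hat\tau_{HT})=\lambda_1\,\widehat{\mathrm{Var}}_{BER}(\hat\tau_{HT})$, where $\lambda_1$ is the largest eigenvalue of the $n\times n$ matrix $\mathbf D=(d_{ij})$, is asymptotically conservative if either: 1. the regularity conditions (Assumption R in the context) hold with $q\ge4$ and $\lambda_1=o\big(n^{1/2}d_{\mathrm{avg}}^{1/2}\big)$; or 2. the regularity conditions (Assumption R) hold with $q\ge 4$, $d_{\mathrm{avg}}=o(n)$, and $\tau_{MSQ}=\Omega(1)$ (i.e. $\liminf_{n\to\infty}\tau_{MSQ}>0$).
   Context: Setting. For each sample size $n$ there are units $U=\{1,\dots,n\}$ and arbitrary potential outcome functions $y_i:\{0,1\}^n\to\mathbb R$, $i\in U$. For $\mathbf z\in\{0,1\}^n$, $\mathbf z_{-i}$ is $\mathbf z$ with its $i$th entry deleted, and $y_i(\mathbf z)$ is also written $y_i(z_i;\mathbf z_{-i})$. An experimental design is the probability distribution of a random vector $\mathbf Z=(Z_1,\dots,Z_n)\in\{0,1\}^n$; it is the only source of randomness. Write $Y_i=y_i(\mathbf Z)$ and $p_i=\Pr(Z_i=1)$. All objects depend on $n$, with no relation assumed between different $n$; asymptotics are as $n\to\infty$. Assumption R (regularity conditions). There are constants $k<\infty$, $q\ge 2$, $s\ge 1$ such that for all $n$ and all $i\in U$: $k^{-1}\le \Pr(Z_i=1)\le 1-k^{-1}$; $E[|Y_i|^q]\le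 k^q$; and $E[|y_i(z;\mathbf Z_{-i})|^s]\le k^s$ for $z\in\{0,1\}$. Bernoulli design: $\Pr(\mathbf Z=\mathbf z)=\prod_{i=1}^n p_i^{z_i}(1-p_i)^{1-z_i}$. Interference. $I_{ij}=1$ if $i=j$ or if $y_j(\mathbf z)\ne y_j(\mathbf z')$ for some $\mathbf z,\mathbf z'\in\{0,1\}^n$ with $\mathbf z_{-i}=\mathbf z'_{-i}$; otherwise $I_{ij}=0$. $d_{ij}=1$ if $I_{\ell i}I_{\ell j}=1$ for some $\ell\in U$, else $d_{ij}=0$ (so $\mathbf D=(d_{ij})$ is symmetric with unit diagonal); $d_{\mathrm{avg}}=n^{-1}\sum_{i,j=1}^n d_{ij}$. $\tau_i(\mathbf z_{-i})=y_i(1;\mathbf z_{-i})-y_i(0;\mathbf z_{-i})$ and $\tau_{MSQ}=\frac1n\sum_{i=1}^n\big(E[\tau_i(\mathbf Z_{-i})]\big)^2$. Estimators: $\hat\tau_{HT}=\frac1n\sum_i \frac{Z_iY_i}{p_i}-\frac1n\sum_i\frac{(1-Z_i)Y_i}{1-p_i}$ and $\widehat{\mathrm{Var}}_{BER}(\hat\tau_{HT})=\frac1{n^2}\sum_i\frac{Z_iY_i^2}{p_i^2}+\frac1{n^2}\sum_i\frac{(1-Z_i)Y_i^2}{(1-p_i)^2}$. A variance estimator $\hat V$ is asymptotically conservative (with respect to the variance of $\hat\tau_{HT}$) if $$\lim_{\varepsilon\to0^+}\lim_{n\to\infty}\Pr\Big(n\,d_{\mathrm{avg}}^{-1}\big[\hat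 V-\mathrm{Var}(\hat\tau_{HT})\big]\le-\varepsilon\Big)=0.$$ *)

(* Defs.v *)
From HB Require Import structures.
From mathcomp Require Import all_boot all_order all_algebra.
From mathcomp Require Import all_classical all_reals all_analysis.

Set Implicit Arguments.
Unset Strict Implicit.
Unset Printing Implicit Defensive.

Import Order.TTheory GRing.Theory Num.Theory.
Import numFieldNormedType.Exports.

Local Open Scope classical_set_scope.
Local Open Scope ring_scope.

Notation assignment n := {ffun 'I_n -> bool}.

Definition potential_outcomes (R : realType) (n : nat) : Type :=
  'I_n -> assignment n -> R.

(* The law of the random vector Z, given by its probability mass function. *)
Record design (R : realType) (n : nat) := Design {
  pmf :> assignment n -> R;
  pmf_ge0 : forall z, 0 <= pmf z;
  pmf_sum1 : \sum_(z : assignment n) pmf z = 1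
}.

Section FixedSampleSize.
Variables (R : realType) (n : nat).
Implicit Types (P : design R n) (y : potential_outcomes R n).
Implicit Types (i j l : 'I_n) (z : assignment n).

Definition prob P (A : pred (assignment n)) : R := \sum_(z | A z) P z.

Definition expect P (X : assignment n -> R) : R :=
  \sum_(z : assignment n) P z * X z.

Definition design_var P (X : assignment n -> R) : R :=
  expect P (fun z => (X z - expect P X) ^+ 2).

Definition treat_prob P i : R := prob P (fun z => z i).

Definition bernoulli_design P : Prop :=
  forall z, P z =
    \prod_(i < n) (treat_prob P i ^+ z i * (1 - treat_prob P i) ^+ (~~ z i)).

Definition set_entry i (b : bool) z : assignment n :=
  [ffun j => if j == i then b else z j].

(* y_i(b; z_{-i}), written as a function of the whole z; it does not depend
   on the i-th entry of z. *)
Definition outcome_at y i (b : bool) z : R := y i (set_entry i b z).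

Definition unit_effect y i z : R :=
  outcome_at y i true z - outcome_at y i false z.

Definition tau_MSQ P y : R :=
  n%:R^-1 * \sum_(i < n) expect P (unit_effect y i) ^+ 2.

Definition agree_off i z z' : bool :=
  [forall j : 'I_n, (j != i) ==> (z j == z' j)].

Definition interferes y i j : bool :=
  (i == j) || [exists z, exists z', agree_off i z z' && (y j z != y j z')].

Definition dependent y i j : bool :=
  [exists l, interferes y l i && interferes y l j].

Definition dep_matrix y : 'M[R]_n := \matrix_(i, j) (dependent y i j)%:R.

Definition d_avg y : R :=
  n%:R^-1 * \sum_(i < n) \sum_(j < n) dep_matrix y i j.

(* The eigenvalues of a matrix form a finite set, so this supremum is a maximum
   as soon as there is an eigenvalue, as is the case for symmetric matrices of
   positive size. *)
Definition largest_eigenvalue (A : 'M[R]_n) : R :=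
  sup [set a | eigenvalue A a].

Definition lambda1 y : R := largest_eigenvalue (dep_matrix y).

Definition tau_HT P y z : R :=
  n%:R^-1 * \sum_(i < n) ((z i)%:R * y i z / treat_prob P i)
  - n%:R^-1 * \sum_(i < n) ((1 - (z i)%:R) * y i z / (1 - treat_prob P i)).

Definition var_BER P y z : R :=
  (n%:R ^+ 2)^-1
    * \sum_(i < n) ((z i)%:R * y i z ^+ 2 / treat_prob P i ^+ 2)
  + (n%:R ^+ 2)^-1
    * \sum_(i < n) ((1 - (z i)%:R) * y i z ^+ 2 / (1 - treat_prob P i) ^+ 2).

Definition var_SR P y z : R := lambda1 y * var_BER P y z.

End FixedSampleSize.

(* Sequences are indexed by all n : nat; the degenerate index n = 0 carries no
   condition and is irrelevant to the limits.  Positivity of k has to be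
   explicit because 0^-1 = 0. *)
Definition regularity (R : realType) (P : forall n, design R n)
    (y : forall n, potential_outcomes R n) (k q s : R) : Prop :=
  [/\ 0 < k, 2 <= q, 1 <= s &
    forall (n : nat) (i : 'I_n),
      [/\ k^-1 <= treat_prob (P n) i <= 1 - k^-1,
          expect (P n) (fun z => `|y n i z| `^ q) <= k `^ q &
          forall b : bool,
            expect (P n) (fun z => `|outcome_at (y n) i b z| `^ s) <= k `^ s]].

(* The inner limit in n is required to exist for every epsilon > 0. *)
Definition asymptotically_conservative (R : realType)
    (P : forall n, design R n) (y : forall n, potential_outcomes R n)
    (V : forall n, assignment n -> R) : Prop :=
  exists L : R -> R,
    (forall eps : R, 0 < eps ->
       prob (P n) (fun z =>
         n%:R * (d_avg (y n))^-1
           * (V n z - design_var (P n) (tau_HT (P n) (y n))) <= - eps)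
       @[n --> \oo] --> L eps)
    /\ L eps @[eps --> 0^'+] --> (0 : R).

(* Main.v *)
(* Let W_i be the i-th Horvitz-Thompson term, so that tau_HT is the mean of the
   W_i, E[W_i] = E[tau_i] and, since Z_i is 0 or 1, the variance estimator is
   (lambda1 / n) S with S the mean of the W_i^2.  Under a Bernoulli design W_i
   and W_j are independent unless d_ij = 1; hence, by the Rayleigh bound for D,
   Var(tau_HT) <= (lambda1 / n^2) sum_i Var(W_i)
                = (lambda1 / n) (E[S] - tau_MSQ),
   and n (V - Var(tau_HT)) / d_avg >= (lambda1 / d_avg) (S - E[S] + tau_MSQ).
   The same covariance structure and the fourth moments give
   Var(S) = O(d_avg / n), and Chebyshev's inequality bounds the probability of a
   negative excess by O(lambda1^2 / (n d_avg)), respectively by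
   O(d_avg / (n tau_MSQ^2)). *)

Require Import Defs.
From HB Require Import structures.
From mathcomp Require Import all_boot all_order all_algebra.
From mathcomp Require Import all_classical all_reals all_analysis.
From mathcomp Require Import ring lra.

Set Implicit Arguments.
Unset Strict Implicit.
Unset Printing Implicit Defensive.

Import Order.TTheory GRing.Theory Num.Theory.
Import numFieldNormedType.Exports.

Local Open Scope classical_set_scope.
Local Open Scope ring_scope.

(** * Quadratic forms and the Rayleigh bound for symmetric matrices *)

Section QuadraticForms.
Variables (R : realType) (n : nat).
Implicit Types (A B M : 'M[R]_n) (x w : 'rV[R]_n).

Definition bilin A x w : R := (x *m A *m w^T) 0 0.
Definition sqnorm x : R := \sum_(i < n) x 0 i ^+ 2.

Lemma bilinE A x w : bilin A x w = \sum_i \sum_j A i j * (x 0 i * w 0 j).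
Proof.
rewrite /bilin mxE exchange_big; apply: eq_bigr => j _ /=.
rewrite !mxE big_distrl /=; apply: eq_bigr => i _.
by rewrite mulrCA mulrA mulrAC.
Qed.

Lemma bilin_scalar c x : bilin c%:M x x = c * sqnorm x.
Proof.
rewrite /bilin mul_mx_scalar -scalemxAl mxE; congr (_ * _).
by rewrite mxE; apply: eq_bigr => i _; rewrite mxE expr2.
Qed.

Lemma sqnorm_ge0 x : 0 <= sqnorm x.
Proof. by apply: sumr_ge0 => i _; exact: sqr_ge0. Qed.

Lemma sqnorm_eq0 x : (sqnorm x == 0) = (x == 0).
Proof.
apply/eqP/eqP => [/eqP|->]; last first.
  by rewrite /sqnorm big1 // => i _; rewrite mxE expr0n.
rewrite psumr_eq0 => [/allP h|i _]; last exact: sqr_ge0.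
apply/rowP => i; rewrite mxE; apply/eqP.
by rewrite -sqrf_eq0; apply: (implyP (h i _)); rewrite ?mem_index_enum.
Qed.

Lemma sqnorm_gt0 x : x != 0 -> 0 < sqnorm x.
Proof. by move=> x0; rewrite lt_neqAle eq_sym sqnorm_eq0 x0 sqnorm_ge0. Qed.

(** Each product of two entries of [x] is at most [sqnorm x] in absolute value. The constant is
    crude, but only its existence matters below. *)
Lemma bilin_ub A x :
  bilin A x x <= (\sum_i \sum_j `|A i j|) * sqnorm x.
Proof.
rewrite bilinE mulr_suml; apply: ler_sum => i _.
rewrite mulr_suml; apply: ler_sum => j _.
have sq k : x 0 k ^+ 2 <= sqnorm x.
  rewrite /sqnorm (bigD1 k) //= lerDl.
  by apply: sumr_ge0 => l _; exact: sqr_ge0.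
apply: (le_trans (ler_norm _)); rewrite normrM ler_wpM2l //.
have := sq i; have := sq j; have := sqr_ge0 (x 0 i - x 0 j).
have := sqr_ge0 (x 0 i + x 0 j).
by rewrite ler_norml => *; apply/andP; split; nra.
Qed.

Lemma bilinC A x w : A^T = A -> bilin A x w = bilin A w x.
Proof.
move=> symA; rewrite !bilinE exchange_big; apply: eq_bigr => i _ /=.
by apply: eq_bigr => j _; rewrite -[in LHS]symA mxE [w 0 i * _]mulrC.
Qed.

Lemma bilin_comb A (s t : R) x w : A^T = A ->
  bilin A (s *: x + t *: w) (s *: x + t *: w) =
  s ^+ 2 * bilin A x x + 2 * s * t * bilin A x w + t ^+ 2 * bilin A w w.
Proof.
move=> symA; have := bilinC w x symA; rewrite /bilin => wx.
rewrite linearD /= !linearZ /= !(mulmxDl, mulmxDr).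
rewrite -!scalemxAl -!scalemxAr.
have mxD (p r : 'M[R]_1) : (p + r) 0 0 = p 0 0 + r 0 0 by rewrite mxE.
have mxZ (a : R) (p : 'M[R]_1) : (a *: p) 0 0 = a * p 0 0 by rewrite mxE.
by rewrite !(mxD, mxZ) wx; ring.
Qed.

Lemma psd_cauchy_schwarz M x w : M^T = M -> (forall v, 0 <= bilin M v v) ->
  bilin M x w ^+ 2 <= bilin M x x * bilin M w w.
Proof.
move=> symM psd.
have key s t : 0 <= s ^+ 2 * bilin M x x + 2 * s * t * bilin M x w
                    + t ^+ 2 * bilin M w w by rewrite -bilin_comb.
move: key (psd x) (psd w).
move: (bilin M x x) (bilin M x w) (bilin M w w) => a b c key a0 c0.
have [c_gt0|] := ltP 0 c.
  (* At [(s, t) = (c, - b)] the form equals [c * (a * c - b ^+ 2)]. *)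
  by have := key c (- b); nra.
move=> c_le0; have {c_le0}c0' : c = 0 by apply/le_anti/andP.
subst c; rewrite mulr0.
have [-> | b0] := eqVneq b 0; first by rewrite expr0n.
(* With [c = 0] and [s = 1] the form is affine in [t]; this [t] gives it the value [- a - 2 < 0]. *)
have := key 1 (- (a + 1) / b).
have -> : 2 * 1 * (- (a + 1) / b) * b = - 2 * (a + 1) by field.
by rewrite mulr0; lra.
Qed.

(** For [w = x *m B^T], [bilin M x w] is [sqnorm x] while [bilin M w w] is at most a constant times
    [sqnorm x]; Cauchy-Schwarz then bounds [bilin M x x] from below. *)
Lemma psd_invertible_coercive M B : M^T = M -> (forall v, 0 <= bilin M v v) ->
  M *m B = 1%:M ->
  exists2 c : R, 0 < c & forall x, c * sqnorm x <= bilin M x x.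
Proof.
move=> symM psd MB.
(* The added 1 makes [C] positive without inspecting [B], even in dimension 0. *)
pose C : R := \sum_i \sum_j `|B^T i j| + 1.
have C0 : 0 < C.
  by apply: ltr_wpDl => //; apply: sumr_ge0 => i _; apply: sumr_ge0.
exists C^-1 => [|x]; first by rewrite invr_gt0.
have [-> | x0] := eqVneq x 0.
  have -> : sqnorm 0 = 0 by apply/eqP; rewrite sqnorm_eq0.
  by rewrite mulr0 psd.
have N0 := sqnorm_gt0 x0.
pose w := x *m B^T.
have xw : bilin M x w = sqnorm x.
  rewrite -[RHS]mul1r -bilin_scalar /bilin /w trmx_mul trmxK.
  by rewrite -(mulmxA x) [M *m _]mulmxA MB mul1mx mulmx1.
have ww : bilin M w w = bilin B^T x x.
  rewrite {1}/bilin {2}/w trmx_mul trmxK.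
  by rewrite -(mulmxA w) [M *m _]mulmxA MB mul1mx.
have := psd_cauchy_schwarz x w symM psd; rewrite xw ww.
have := bilin_ub B^T x; rewrite ler_pdivrMl //.
have := psd x; rewrite /C; nra.
Qed.

End QuadraticForms.

(* The least [l] with [bilin A x x <= l * sqnorm x] for all [x] makes [l - A]
   positive semidefinite but not coercive, hence singular: it is an
   eigenvalue. *)
Lemma rayleigh_le (R : realType) (n : nat) (A : 'M[R]_n) (x : 'rV[R]_n) :
  A^T = A -> bilin A x x <= largest_eigenvalue A * sqnorm x.
Proof.
move=> symA.
have [->|x0] := eqVneq x 0.
  have -> : sqnorm (0 : 'rV[R]_n) = 0 by apply/eqP; rewrite sqnorm_eq0.
  rewrite bilinE mulr0 big1 // => i _; rewrite big1 // => j _.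
  by rewrite !mxE !mul0r mulr0.
pose S := [set c : R | forall v, bilin A v v <= c * sqnorm v].
have S0 : S !=set0 by exists (\sum_i \sum_j `|A i j|) => v; exact: bilin_ub.
have lbS v : v != 0 -> lbound S (bilin A v v / sqnorm v).
  by move=> v0 c Sc; rewrite ler_pdivrMr ?sqnorm_gt0 //; exact: Sc.
have hlbS : has_lbound S by exists (bilin A x x / sqnorm x); exact: lbS.
pose l := inf S.
(* The infimum is attained: every Rayleigh quotient is a lower bound of [S], hence at most [l]. *)
have Sl : S l.
  move=> v; have [->|v0] := eqVneq v 0.
    case: S0 => c /(_ 0).
    by have -> : sqnorm (0 : 'rV[R]_n) = 0
      by [apply/eqP; rewrite sqnorm_eq0|]; rewrite !mulr0.
  by rewrite -ler_pdivrMr ?sqnorm_gt0 //; apply: lb_le_inf => //; exact: lbS.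
pose M := l%:M - A.
have ME v : bilin M v v = l * sqnorm v - bilin A v v.
  by rewrite -bilin_scalar /bilin mulmxBr mulmxBl !mxE.
have symM : M^T = M by rewrite /M linearB /= tr_scalar_mx symA.
have psd v : 0 <= bilin M v v by rewrite ME subr_ge0; exact: Sl.
have eig : eigenvalue A l.
  rewrite /eigenvalue; apply/negP; rewrite /eigenspace kermx_eq0.
  rewrite row_free_unit => unitN.
  have MB : M *m (- invmx (A - l%:M)) = 1%:M.
    by rewrite mulmxN -mulNmx /M opprB mulmxV.
  have [c c0 hc] := psd_invertible_coercive symM psd MB.
  have : S (l - c) by move=> v; have := hc v; rewrite ME; lra.
  by move=> /(ge_inf hlbS); rewrite -/l; lra.
apply: (le_trans (Sl x)); rewrite ler_wpM2r ?sqnorm_ge0 //.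
(* Comparing [l] with the supremum requires the spectrum to be bounded above; [l] itself is a bound,
   since an eigenvector for [a] has Rayleigh quotient [a]. *)
apply: ub_le_sup => //; exists l => a /= /eigenvalueP [v Av v0].
rewrite -(ler_pM2r (sqnorm_gt0 v0)) -bilin_scalar.
suff -> : bilin a%:M v v = bilin A v v by exact: Sl.
by rewrite /bilin Av mul_mx_scalar.
Qed.

(** * Expectation under a design, and independence under Bernoulli assignment *)

Section Expectation.
Variables (R : realType) (n : nat) (P : design R n).
Implicit Types (X Y : assignment n -> R) (A B : {pred 'I_n}) (i j l : 'I_n).
Implicit Types (z w : assignment n).

Lemma eq_expect X Y : X =1 Y -> expect P X = expect P Y.
Proof. by move=> XY; apply: eq_bigr => z _; rewrite XY. Qed.

Lemma expectD X Y : expect P (fun z => X z + Y z) = expect P X + expect P Y.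
Proof. by rewrite -big_split; apply: eq_bigr => z _; rewrite mulrDr. Qed.

Lemma expectZ a X : expect P (fun z => a * X z) = a * expect P X.
Proof. by rewrite mulr_sumr; apply: eq_bigr => z _; rewrite mulrCA. Qed.

Lemma expect_cst a : expect P (fun=> a) = a.
Proof. by rewrite /expect -mulr_suml pmf_sum1 mul1r. Qed.

Lemma expectB X Y : expect P (fun z => X z - Y z) = expect P X - expect P Y.
Proof.
rewrite -[- expect P Y]mulN1r -expectZ -expectD.
by apply: eq_expect => z; rewrite mulN1r.
Qed.

Lemma expect_sum (I : finType) (F : I -> assignment n -> R) :
  expect P (fun z => \sum_i F i z) = \sum_i expect P (F i).
Proof.
by rewrite exchange_big; apply: eq_bigr => z _; rewrite mulr_sumr.
Qed.

Lemma le_expect X Y : (forall z, X z <= Y z) -> expect P X <= expect P Y.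
Proof. by move=> XY; apply: ler_sum => z _; rewrite ler_wpM2l ?Defs.pmf_ge0. Qed.

Lemma expect_ge0 X : (forall z, 0 <= X z) -> 0 <= expect P X.
Proof. by move=> X0; apply: sumr_ge0 => z _; rewrite mulr_ge0 ?Defs.pmf_ge0. Qed.

Lemma le_prob (E F : pred (assignment n)) :
  (forall z, E z -> F z) -> prob P E <= prob P F.
Proof.
move=> EF; rewrite /prob big_mkcond [leRHS]big_mkcond; apply: ler_sum => z _.
by case: ifPn => [/EF ->//|_]; case: ifP => // _; exact: Defs.pmf_ge0.
Qed.

Lemma prob_ge0 (E : pred (assignment n)) : 0 <= prob P E.
Proof. by apply: sumr_ge0 => z _; exact: Defs.pmf_ge0. Qed.

Lemma chebyshev_design X (t : R) : 0 < t ->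
  prob P (fun z => t <= `|X z - expect P X|) <= design_var P X / t ^+ 2.
Proof.
move=> t0; rewrite ler_pdivlMr ?exprn_gt0 // /prob big_mkcond mulr_suml.
apply: ler_sum => z _; case: ifPn => [tX|_]; last first.
  by rewrite mul0r mulr_ge0 ?Defs.pmf_ge0 ?sqr_ge0.
rewrite ler_wpM2l ?Defs.pmf_ge0 // -[leRHS]real_normK ?num_real //.
by rewrite lerXn2r ?nnegrE // ltW.
Qed.

Lemma treat_probE i : treat_prob P i = expect P (fun z => (z i)%:R).
Proof.
rewrite /treat_prob /prob big_mkcond; apply: eq_bigr => z _.
by case: (z i); rewrite ?mulr1 ?mulr0.
Qed.

Definition depends_on A X :=
  forall z w, {in A, forall i, z i = w i} -> X z = X w.

Definition mix A z w : assignment n := [ffun i => if i \in A then z i else w i].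

Lemma mixK A z w : mix A (mix A z w) (mix A w z) = z.
Proof. by apply/ffunP => i; rewrite !ffunE; case: (i \in A). Qed.

(** At each unit the mixed pair contributes the same two factors as the original pair, possibly in
    the other order. *)
Lemma bernoulli_mix A z w : bernoulli_design P ->
  P (mix A z w) * P (mix A w z) = P z * P w.
Proof.
move=> ber; rewrite !ber -!big_split; apply: eq_bigr => i _ /=.
by rewrite !ffunE; case: (i \in A); rewrite // mulrC.
Qed.

(* Swapping the coordinates outside [A] between two independent copies of Z
   preserves their joint law. *)
Lemma expect_indep A B X Y : bernoulli_design P ->
  depends_on A X -> depends_on B Y -> (forall i, i \in B -> i \notin A) ->
  expect P (fun z => X z * Y z) = expect P X * expect P Y.
Proof.
move=> ber dX dY AB.
pose swap (u : assignment n * assignment n) := (mix A u.1 u.2, mix A u.2 u.1).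
have swapK : involutive swap by move=> [z w]; rewrite /swap /= !mixK.
(* The factor 1, as total mass, introduces the independent copy [w]; after the swap [X] sees only
   [z] and [Y] only [w]. *)
rewrite -[LHS]mulr1 -(pmf_sum1 P) /expect !big_distrlr /=.
rewrite !pair_big /= (reindex_inj (inv_inj swapK)) /=.
apply: eq_bigr => -[z w] _ /=.
rewrite mulrAC bernoulli_mix // (dX (mix A z w) z); last first.
  by move=> i iA; rewrite ffunE iA.
rewrite (dY (mix A z w) w); last first.
  by move=> i iB; rewrite ffunE (negPf (AB i iB)).
by rewrite mulrACA.
Qed.

(** Pass from [z] to [w] one coordinate at a time: a coordinate that interferes with [j] does not
    change, and any other leaves [y j] fixed by definition of [interferes]. *)
Lemma depends_outcome y j :
  depends_on [pred l | interferes (R:=R) y l j] (y j).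
Proof.
move=> z w zw.
pose upd (s : seq 'I_n) : assignment n :=
  [ffun l => if l \in s then w l else z l].
have yupd s : y j (upd s) = y j z.
  elim: s => [|l s <-]; first by congr y; apply/ffunP => l; rewrite ffunE.
  have [lj|] := boolP (interferes y l j).
    congr y; apply/ffunP => m; rewrite !ffunE inE.
    case: eqVneq => [->|//] /=.
    by rewrite zw ?inE // if_same.
  rewrite negb_or => /andP[_ /existsPn /(_ (upd (l :: s))) /existsPn /(_ (upd s))].
  rewrite negb_and negbK => /orP[/negP[]|/eqP//].
  by apply/forallP => m; apply/implyP => ml; rewrite !ffunE inE (negPf ml).
rewrite -(yupd (enum 'I_n)); congr y.
by apply/ffunP => l; rewrite ffunE mem_enum inE.
Qed.

Lemma expect_cov X Y :
  expect P (fun z => (X z - expect P X) * (Y z - expect P Y))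
  = expect P (fun z => X z * Y z) - expect P X * expect P Y.
Proof.
transitivity (expect P (fun z => X z * Y z
   - (expect P Y * X z + expect P X * Y z - expect P X * expect P Y))).
  by apply: eq_expect => z; ring.
by rewrite !(expectB, expectD) !expectZ expect_cst; ring.
Qed.

Lemma design_varE X :
  design_var P X = expect P (fun z => X z ^+ 2) - expect P X ^+ 2.
Proof.
by rewrite expr2 -(expect_cov X X); apply: eq_expect => z; rewrite expr2.
Qed.

Lemma design_varZ a X :
  design_var P (fun z => a * X z) = a ^+ 2 * design_var P X.
Proof.
rewrite /design_var -expectZ expectZ; apply: eq_expect => z.
by rewrite -mulrBr exprMn.
Qed.

(** When [d_ij = 0], no coordinate interferes with both [i] and [j], so [X i] and [X j] are
    independent and their covariance vanishes. This applies both to the Horvitz-Thompson terms and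
    to their squares. *)
Lemma design_var_sum y (X : 'I_n -> assignment n -> R) : bernoulli_design P ->
  (forall i, depends_on [pred l | interferes y l i] (X i)) ->
  design_var P (fun z => \sum_i X i z) =
  \sum_i \sum_j dep_matrix y i j *
    expect P (fun z => (X i z - expect P (X i)) * (X j z - expect P (X j))).
Proof.
move=> ber dX; rewrite /design_var expect_sum.
transitivity (expect P (fun z => \sum_i \sum_j
    (X i z - expect P (X i)) * (X j z - expect P (X j)))).
  by apply: eq_expect => z; rewrite -sumrB expr2 big_distrlr.
rewrite expect_sum; apply: eq_bigr => i _; rewrite expect_sum.
apply: eq_bigr => j _; rewrite mxE.
have [_|nd] := boolP (dependent y i j); first by rewrite mul1r.
rewrite mul0r expect_cov (@expect_indep _ _ _ _ ber (dX i) (dX j)) ?subrr //.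
move=> l; rewrite !inE => lj; apply: contra nd => li.
by apply/existsP; exists l; rewrite li.
Qed.

End Expectation.

(** * Horvitz-Thompson terms, their means and variances *)

Section HorvitzThompson.
Variables (R : realType) (n : nat) (P : design R n) (y : potential_outcomes R n).
Hypothesis ber : bernoulli_design P.
Hypothesis treat_prob01 : forall i, 0 < treat_prob P i < 1.
Implicit Types (i j l : 'I_n) (z w : assignment n).

(** This is W_i of the overview, and [ht_sq_mean] is S. *)
Definition ht_term i z : R :=
  (z i)%:R * y i z / treat_prob P i
  - (1 - (z i)%:R) * y i z / (1 - treat_prob P i).

Definition ht_sq_mean z : R := n%:R^-1 * \sum_i ht_term i z ^+ 2.

Lemma tau_HTE z : tau_HT P y z = n%:R^-1 * \sum_i ht_term i z.
Proof. by rewrite /tau_HT -mulrBr -sumrB. Qed.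

(** One half of [ht_term] is always zero, so its square has no cross term. *)
Lemma var_SRE z : var_SR P y z = lambda1 y * (n%:R^-1 * ht_sq_mean z).
Proof.
rewrite /var_SR /var_BER /ht_sq_mean -mulrDr -big_split mulrA -invfM -expr2.
congr (_ * (_ * _)); apply: eq_bigr => i _; rewrite /ht_term /=.
have /andP[p0 p1] := treat_prob01 i.
by case: (z i) => /=; field; rewrite ?gt_eqF ?subr_gt0.
Qed.

(** The term also reads [z i], which the reflexive clause of [interferes] covers. *)
Lemma depends_ht_term i : depends_on [pred l | interferes y l i] (ht_term i).
Proof.
move=> z w zw; rewrite /ht_term (depends_outcome zw) zw //.
by rewrite !inE /interferes eqxx.
Qed.

Lemma depends_outcome_at i b : depends_on [pred l | l != i] (outcome_at y i b).
Proof.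
move=> z w zw; congr y; apply/ffunP => l; rewrite !ffunE.
by case: eqVneq => // li; apply: zw.
Qed.

(** [outcome_at y i b] ignores entry [i], hence is independent of the treatment of [i], whose
    probability cancels the weight. *)
Lemma expect_ht_term i : expect P (ht_term i) = expect P (unit_effect y i).
Proof.
have /andP[p0 p1] := treat_prob01 i.
have set_id z : set_entry i (z i) z = z.
  by apply/ffunP => l; rewrite ffunE; case: eqVneq => // ->.
have indep b (f : assignment n -> R) : depends_on [pred l | l == i] f ->
    expect P (fun z => f z * outcome_at y i b z)
    = expect P f * expect P (outcome_at y i b).
  move=> df; apply: (expect_indep ber df (@depends_outcome_at i b)).
  by move=> l; rewrite !inE.
transitivity (expect P (fun z =>
    (treat_prob P i)^-1 * ((z i)%:R * outcome_at y i true z)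
    - (1 - treat_prob P i)^-1 * ((1 - (z i)%:R) * outcome_at y i false z))).
  (* Writing the argument of each outcome as [set_entry i (z i) z] exposes [outcome_at] at the
     realised treatment. *)
  apply: eq_expect => z; rewrite /ht_term /outcome_at -{2 4}(set_id z).
  by case: (z i) => /=; rewrite ?subrr ?subr0; ring.
rewrite !(expectB, expectZ) !indep.
- rewrite expectB expect_cst -treat_probE; field.
  by rewrite !gt_eqF ?subr_gt0.
- by move=> z w zw; rewrite zw ?inE.
- by move=> z w zw; rewrite zw ?inE.
Qed.

Lemma dep_matrix_sym : (dep_matrix y : 'M[R]_n)^T = dep_matrix y.
Proof.
apply/matrixP => i j; rewrite !mxE /dependent.
by under eq_existsb do rewrite andbC.
Qed.

Lemma dep_matrix_diag i : dep_matrix y i i = 1 :> R.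
Proof.
rewrite mxE (_ : dependent y i i) //.
by apply/existsP; exists i; rewrite /interferes eqxx.
Qed.

Lemma dep_matrix_ge0 i j : 0 <= dep_matrix y i j :> R.
Proof. by rewrite mxE. Qed.

Lemma design_var_tau_HT : (0 < n)%N ->
  design_var P (tau_HT P y)
  <= lambda1 y * (n%:R^-1 * (expect P ht_sq_mean - tau_MSQ P y)).
Proof.
move=> n0; have nR : 0 < n%:R :> R by rewrite ltr0n.
have -> : design_var P (tau_HT P y)
    = n%:R^-1 ^+ 2 * design_var P (fun z => \sum_i ht_term i z).
  rewrite -design_varZ /design_var.
  have tauE : tau_HT P y =1 fun z => n%:R^-1 * \sum_i ht_term i z := tau_HTE.
  by rewrite (eq_expect P tauE); apply: eq_expect => z; rewrite tauE.
rewrite (design_var_sum ber depends_ht_term).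
pose X z : 'rV[R]_n := \row_i (ht_term i z - expect P (ht_term i)).
under eq_bigr do (under eq_bigr do rewrite -expectZ; rewrite -expect_sum).
rewrite -expect_sum.
(* The Rayleigh bound is applied to the vector of centred terms for each fixed [z], and only then
   averaged. *)
have le : expect P (fun z => \sum_i \sum_j dep_matrix y i j *
    ((ht_term i z - expect P (ht_term i)) * (ht_term j z - expect P (ht_term j))))
    <= expect P (fun z => lambda1 y * sqnorm (X z)).
  apply: le_expect => z; apply: le_trans (rayleigh_le (X z) dep_matrix_sym).
  rewrite bilinE; apply: ler_sum => i _; apply: ler_sum => j _.
  by rewrite !mxE.
apply: (le_trans (ler_wpM2l _ le)); first exact: sqr_ge0.
rewrite expectZ mulrCA le_eqVlt; apply/orP; left; apply/eqP; congr (_ * _).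
rewrite /ht_sq_mean expectZ /tau_MSQ -mulrBr mulrA -expr2; congr (_ * _).
rewrite !expect_sum -sumrB; apply: eq_bigr => i _.
rewrite -expect_ht_term -design_varE.
by apply: eq_expect => z; rewrite mxE.
Qed.

Lemma d_avg_ge1 : (0 < n)%N -> 1 <= d_avg y :> R.
Proof.
move=> n0; rewrite /d_avg ler_pdivlMl ?ltr0n // mulr1.
rewrite -[n%:R](_ : \sum_(i < n) 1 = _); last by rewrite sumr_const card_ord.
apply: ler_sum => i _; rewrite -(dep_matrix_diag i) (bigD1 i) //= lerDl.
by apply: sumr_ge0 => j _; exact: dep_matrix_ge0.
Qed.

(** At the all-ones vector the form is the sum of the entries of D, which are nonnegative. *)
Lemma lambda1_ge0 : (0 < n)%N -> 0 <= lambda1 y :> R.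
Proof.
move=> n0; have := rayleigh_le (const_mx 1) dep_matrix_sym.
have -> : sqnorm (const_mx 1 : 'rV[R]_n) = n%:R.
  rewrite /sqnorm; under eq_bigr do rewrite mxE expr1n.
  by rewrite sumr_const card_ord.
rewrite bilinE => le; rewrite -(pmulr_lge0 _ (_ : 0 < n%:R :> R)) ?ltr0n //.
apply: le_trans le; apply: sumr_ge0 => i _; apply: sumr_ge0 => j _.
by rewrite !mxE !mulr1.
Qed.

(** Each surviving covariance is at most E[W_i^2 W_j^2], hence at most [K] by the
    arithmetic-geometric mean inequality; there are [n * d_avg] such pairs. *)
Lemma design_var_ht_sq_mean (K : R) : (0 < n)%N ->
  (forall i, expect P (fun z => ht_term i z ^+ 4) <= K) ->
  design_var P ht_sq_mean <= K * d_avg y / n%:R.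
Proof.
move=> n0 mom.
have nR : 0 < n%:R :> R by rewrite ltr0n.
rewrite /ht_sq_mean design_varZ.
rewrite (@design_var_sum _ _ _ y (fun i z => ht_term i z ^+ 2)) //; last first.
  by move=> i z w zw; rewrite (depends_ht_term zw).
rewrite /d_avg [leRHS](_ : _ = n%:R^-1 ^+ 2 *
    \sum_i \sum_j dep_matrix y i j * K); last first.
  rewrite [in RHS](eq_bigr (fun i => K * \sum_j dep_matrix y i j)).
    by rewrite -mulr_sumr; ring.
  by move=> i _; rewrite mulr_sumr; apply: eq_bigr => j _; rewrite mulrC.
rewrite ler_wpM2l ?sqr_ge0 //; apply: ler_sum => i _; apply: ler_sum => j _.
rewrite ler_wpM2l ?dep_matrix_ge0 // expect_cov.
have le : expect P (fun z => ht_term i z ^+ 2 * ht_term j z ^+ 2) <=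
    expect P (fun z => 2^-1 * (ht_term i z ^+ 4 + ht_term j z ^+ 4)).
  apply: le_expect => z.
  by have := sqr_ge0 (ht_term i z ^+ 2 - ht_term j z ^+ 2); nra.
rewrite expectZ expectD in le.
have e0 l : 0 <= expect P (fun z => ht_term l z ^+ 2).
  by apply: expect_ge0 => z; exact: sqr_ge0.
have := mulr_ge0 (e0 i) (e0 j); have := mom i; have := mom j; lra.
Qed.

End HorvitzThompson.

(** * Finite-sample tail bounds for the scaled excess *)

Section TailBounds.
Variables (R : realType) (n : nat) (P : design R n) (y : potential_outcomes R n).
Variables (k q : R).
Hypothesis n_gt0 : (0 < n)%N.
Hypothesis ber : bernoulli_design P.
Hypothesis k_gt0 : 0 < k.
Hypothesis q_ge4 : 4 <= q.
Hypothesis treat_prob_bnd : forall i, k^-1 <= treat_prob P i <= 1 - k^-1.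
Hypothesis moment_bnd :
  forall i, expect P (fun z => `|y i z| `^ q) <= k `^ q.

Let kV_gt0 : 0 < k^-1. Proof. by rewrite invr_gt0. Qed.

Let treat_prob01 i : 0 < treat_prob P i < 1.
Proof.
have := kV_gt0; have /andP[] := treat_prob_bnd i => pk p1k kV0.
by apply/andP; split; lra.
Qed.

(** Splitting at [|a| = 1] reduces fourth moments to moments of any real order [q >= 4], at the cost
    of the added 1. *)
Lemma expr4_le_powR (a : R) : a ^+ 4 <= 1 + `|a| `^ q.
Proof.
have -> : a ^+ 4 = `|a| ^+ 4 by rewrite -normrX ger0_norm // exprn_even_ge0.
have [a1|/ltW a1] := leP `|a| 1.
  by rewrite (le_trans (exprn_ile1 _ (normr_ge0 a) a1)) // lerDl powR_ge0.
by rewrite -powR_mulrn // (le_trans (ler_powR a1 q_ge4)) // lerDr.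
Qed.

(** Only one half of the term is active and its inverse weight is at most [k], so |W_i| is at most
    [k] times |Y_i|. *)
Lemma expect_ht_term4 i :
  expect P (fun z => ht_term P y i z ^+ 4) <= k ^+ 4 * (1 + k `^ q).
Proof.
have /andP[p0 p1] := treat_prob01 i; have /andP[pk p1k] := treat_prob_bnd i.
have inv_le (p : R) : 0 < p -> k^-1 <= p -> p^-1 ^+ 4 <= k ^+ 4.
  move=> pp kp; rewrite lerXn2r ?nnegrE ?invr_ge0 ?(ltW pp) ?(ltW k_gt0) //.
  by rewrite -[leRHS]invrK lef_pV2.
apply: le_trans (_ : expect P (fun z => k ^+ 4 * (1 + `|y i z| `^ q)) <= _).
  apply: le_expect => z.
  apply: le_trans (_ : k ^+ 4 * y i z ^+ 4 <= _); last first.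
    by rewrite ler_wpM2l ?exprn_ge0 ?(ltW k_gt0) // expr4_le_powR.
  rewrite /ht_term; case: (z i) => /=.
    rewrite subrr !mul0r subr0 mul1r exprMn mulrC.
    by rewrite ler_wpM2r ?exprn_even_ge0 // inv_le.
  rewrite !mul0r sub0r subr0 mul1r exprNn exprMn mulrC -signr_odd expr0 mulr1.
  by rewrite mulrC ler_wpM2r ?exprn_even_ge0 // inv_le ?subr_gt0 //; lra.
rewrite expectZ expectD expect_cst ler_wpM2l ?exprn_ge0 ?(ltW k_gt0) //.
by rewrite lerD2l.
Qed.

Let K : R := k ^+ 4 * (1 + k `^ q).
Let S := ht_sq_mean P y.
Let gap z : R :=
  n%:R * (d_avg y)^-1 * (var_SR P y z - design_var P (tau_HT P y)).

(** Replacing the variance by its bound from [design_var_tau_HT] turns the gap into exactly the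
    left-hand side. *)
Lemma gap_ge z :
  lambda1 y / d_avg y * (S z - expect P S + tau_MSQ P y) <= gap z.
Proof.
have nR : 0 < n%:R :> R by rewrite ltr0n.
have d0 : 0 < d_avg y := lt_le_trans ltr01 (d_avg_ge1 y n_gt0).
have -> : lambda1 y / d_avg y * (S z - expect P S + tau_MSQ P y) =
  n%:R * (d_avg y)^-1 * (var_SR P y z
    - lambda1 y * (n%:R^-1 * (expect P S - tau_MSQ P y))).
  by rewrite (var_SRE _ treat_prob01) -/S; field; rewrite !gt_eqF.
apply: ler_wpM2l; first by rewrite divr_ge0 ?ltW.
by rewrite lerB // design_var_tau_HT.
Qed.

Lemma prob_ht_sq_mean_dev (t : R) : 0 < t ->
  prob P (fun z => t <= `|S z - expect P S|) <= K * d_avg y / n%:R / t ^+ 2.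
Proof.
move=> t0; apply: (le_trans (chebyshev_design _ _ t0)).
rewrite ler_wpM2r ?invr_ge0 ?sqr_ge0 //.
by apply: design_var_ht_sq_mean => //; exact: expect_ht_term4.
Qed.

Lemma tau_MSQ_ge0 : 0 <= tau_MSQ P y.
Proof.
by rewrite mulr_ge0 ?invr_ge0 ?ler0n // sumr_ge0 // => i _; exact: sqr_ge0.
Qed.

(** Since [tau_MSQ] is nonnegative, a gap below [- eps] forces S to deviate from its mean by at
    least [eps * d_avg / lambda1]. *)
Lemma prob_gap_lambda1 (eps : R) : 0 < eps ->
  prob P (fun z => gap z <= - eps)
  <= K * (lambda1 y ^+ 2 / (n%:R * d_avg y)) / eps ^+ 2.
Proof.
move=> e0.
have nR : 0 < n%:R :> R by rewrite ltr0n.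
have d0 : 0 < d_avg y := lt_le_trans ltr01 (d_avg_ge1 y n_gt0).
(* If [lambda1] is 0 this threshold is undefined, but then the gap is nonnegative and the event is
   empty. *)
have := lambda1_ge0 y n_gt0; rewrite le_eqVlt => /predU1P[l0|l0].
  rewrite -l0 expr0n mul0r mulr0 mul0r /prob big_pred0 // => z.
  apply/negbTE; rewrite -ltNge; apply: lt_le_trans (gap_ge z).
  by rewrite -l0 !mul0r oppr_lt0.
have t0 : 0 < eps * d_avg y / lambda1 y.
  by apply: divr_gt0 => //; exact: mulr_gt0.
apply: le_trans (_ : K * d_avg y / n%:R / (eps * d_avg y / lambda1 y) ^+ 2 <= _).
  apply: le_trans (prob_ht_sq_mean_dev t0); apply: le_prob => z.
  move=> /(le_trans (gap_ge z)) h; rewrite ler_pdivrMr //.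
  have /(le_trans _) : `|S z - expect P S| * lambda1 y
    >= - (S z - expect P S) * lambda1 y.
    by apply: ler_wpM2r; rewrite ?(ltW l0) // -normrN ler_norm.
  apply; rewrite -ler_pdivlMr // -subr_ge0.
  have := mulr_ge0 (ltW (divr_gt0 l0 d0)) tau_MSQ_ge0.
  have -> : lambda1 y / d_avg y * tau_MSQ P y =
     lambda1 y / d_avg y * (S z - expect P S + tau_MSQ P y)
     + - (S z - expect P S) * lambda1 y / d_avg y by ring.
  lra.
by rewrite le_eqVlt; apply/orP; left; apply/eqP; field; rewrite !gt_eqF.
Qed.

(** A negative gap already forces S to fall below its mean by at least [tau_MSQ], so the bound is
    uniform in [eps]. *)
Lemma prob_gap_tau_MSQ (eps : R) : 0 < eps -> 0 < tau_MSQ P y ->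
  prob P (fun z => gap z <= - eps)
  <= K * (d_avg y / n%:R) / tau_MSQ P y ^+ 2.
Proof.
move=> e0 t0; rewrite mulrA.
have d0 : 0 < d_avg y := lt_le_trans ltr01 (d_avg_ge1 y n_gt0).
apply: le_trans (prob_ht_sq_mean_dev t0); apply: le_prob => z.
move=> /(le_trans (gap_ge z)) h; rewrite leNgt; apply/negP.
rewrite ltr_norml => /andP[lo _].
have : 0 <= lambda1 y / d_avg y * (S z - expect P S + tau_MSQ P y).
  by rewrite mulr_ge0 ?divr_ge0 ?lambda1_ge0 ?(ltW d0) //; lra.
lra.
Qed.

End TailBounds.

(** * Passage to the limit *)

(** The lower limit is the supremum of the tail infima, so one of these is positive; it is finite,
    being at most a term of the sequence, and serves as [c]. *)
Lemma limn_einf_gt0 (R : realType) (u : R^nat) :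
  (0 < limn_einf (fun n => (u n)%:E))%E ->
  exists2 c : R, 0 < c & \forall n \near \oo, c <= u n.
Proof.
rewrite limn_einf_lim (cvg_lim _ (@cvg_einfs_sup _ _)) // => /ereal_sup_gt.
move=> [_ [m _ <-]]; rewrite /einfs /=.
have lb n : (m <= n)%N -> (ereal_inf (sdrop (fun n => (u n)%:E) m) <= (u n)%:E)%E.
  by move=> mn; apply: ereal_inf_lbound; exists n.
case: ereal_inf lb => [c|/(_ m (leqnn m))|] // lb c0.
by exists c => //; exists m => // n /lb; rewrite lee_fin.
Qed.

Theorem proposition10 (R : realType) (P : forall n : nat, design R n)
    (y : forall n : nat, potential_outcomes R n) :
  (forall n : nat, bernoulli_design (P n)) ->
  ((exists k q s : R, regularity P y k q s /\ 4 <= q)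
     /\ (fun n : nat => lambda1 (y n))
          =o_\oo (fun n : nat => Num.sqrt (n%:R : R) * Num.sqrt (d_avg (y n))))
  \/ [/\ exists k q s : R, regularity P y k q s /\ 4 <= q,
         (fun n : nat => d_avg (y n)) =o_\oo (fun n : nat => n%:R : R) &
         (0 < limn_einf (fun n : nat => (tau_MSQ (P n) (y n))%:E))%E] ->
  asymptotically_conservative P y (fun n : nat => var_SR (P n) (y n)).
Proof.
(* The probability tends to 0 for every fixed [eps], so the outer limit is that of a constant. *)
move=> ber hyp; exists (fun=> 0); split; last exact: cvg_cst.
move=> eps eps0; apply/cvgrPdist_le => e e0.
have [k [q [s [[k0 _ _ reg] q4]]]] : exists k q s : R, regularity P y k q s /\ 4 <= q.
  by case: hyp => -[].
have tp n i : k^-1 <= treat_prob (P n) i <= 1 - k^-1 by case: (reg n i).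
have mom n i : expect (P n) (fun z => `|y n i z| `^ q) <= k `^ q.
  by case: (reg n i).
pose K : R := k ^+ 4 * (1 + k `^ q).
have K0 : 0 < K by rewrite mulr_gt0 ?exprn_gt0 // ltr_pwDl // powR_ge0.
have d1 n : (0 < n)%N -> 0 < d_avg (y n).
  by move=> n0; exact: lt_le_trans ltr01 (d_avg_ge1 (y n) n0).
have pos c : 0 < c -> 0 < e * c ^+ 2 / K.
  by move=> c0; apply: divr_gt0 => //; apply: mulr_gt0 => //; exact: exprn_gt0.
case: hyp => [[_ /eqoP lo]|[_ /eqoP lo /limn_einf_gt0 [c c0 tau_ge]]].
(* This little-o constant, once squared, makes the bound of [prob_gap_lambda1] at most [e]. *)
- have a0 : 0 < Num.sqrt (e * eps ^+ 2 / K) by rewrite sqrtr_gt0 pos.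
  near=> n.
  have n0 : (0 < n)%N by near: n; exact: nbhs_infty_gt.
  have nR : 0 < n%:R :> R by rewrite ltr0n.
  rewrite sub0r normrN ger0_norm ?prob_ge0 //.
  apply: (le_trans (prob_gap_lambda1 n0 (ber n) k0 q4 (tp n) (mom n) eps0)).
  rewrite -/K ler_pdivrMr ?exprn_gt0 // -ler_pdivlMl // [leRHS]mulrC.
  rewrite ler_pdivrMr; last by apply: mulr_gt0 => //; exact: d1.
  have : `|lambda1 (y n)| <= Num.sqrt (e * eps ^+ 2 / K) *
      `|Num.sqrt (n%:R : R) * Num.sqrt (d_avg (y n))|.
    by near: n; exact: lo.
  move=> le; have := ler_pM (normr_ge0 _) (normr_ge0 _) le le; rewrite -!expr2.
  rewrite exprMn !real_normK ?num_real // exprMn.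
  rewrite (sqr_sqrtr (ltW (pos _ _))) //.
  by rewrite (sqr_sqrtr (ltW nR)) (sqr_sqrtr (ltW (d1 _ n0))).
(* With this constant, and [c] eventually below [tau_MSQ], the bound of [prob_gap_tau_MSQ] is at
   most [e]. *)
- have a0 : 0 < e * c ^+ 2 / K := pos _ c0.
  near=> n.
  have n0 : (0 < n)%N by near: n; exact: nbhs_infty_gt.
  have nR : 0 < n%:R :> R by rewrite ltr0n.
  have cn : c <= tau_MSQ (P n) (y n) by near: n.
  have t0 := lt_le_trans c0 cn.
  rewrite sub0r normrN ger0_norm ?prob_ge0 //.
  apply: (le_trans (prob_gap_tau_MSQ n0 (ber n) k0 q4 (tp n) (mom n) eps0 t0)).
  rewrite -/K ler_pdivrMr ?exprn_gt0 // -ler_pdivlMl // [leRHS]mulrC ler_pdivrMr //.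
  have : `|d_avg (y n)| <= e * c ^+ 2 / K * `|n%:R : R| by near: n; exact: lo.
  rewrite (ger0_norm (ltW (d1 _ n0))) (ger0_norm (ltW nR)) => /le_trans; apply.
  rewrite ler_pM2r // ler_pM2r ?invr_gt0 // ler_pM2l //.
  by rewrite lerXn2r ?nnegrE // ltW.
Unshelve. all: by end_near. Qed.
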